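(* Let $(X,\rho)$ be a Hadamard space, let $K\subset X$ be nonempty, closed and convex, and let $F:K\times K\to\mathbb{R}$ be a monotone bifunction with $\mathcal{E}(K,F)\neq\varnothing$ such that $x\mapsto F(x,y)$ is $\Delta$-upper semicontinuous on $K$ for every $y\in K$, and such that $\operatorname{dom}(J_{\mu F})\supset K$ for all $\mu>0$. Let $(\lambda_k)\subset(0,\infty)$ be bounded away from $0$. Then, for any $x^0\in K$, the sequence generated by the proximal algorithm $$x^{k}:=J_{\lambda_kF}(x^{k-1}),\qquad k\in\mathbb{N},$$ is $\Delta$-convergent to an element of $\mathcal{E}(K,F)$.
   Context: A Hadamard space is a complete CAT(0) space. For $u,v,x,y\in X$ write $\overrightarrow{uv}:=(u,v)$ and $\langle\overrightarrow{uv},\overrightarrow{xy}\rangle := \tfrac12[\rho^2(u,y)+\rho^2(v,x)-\rho^2(u,x)-\rho^2(v,y)]$. $\mathcal{E}(K,F):=\{\bar x\in K: F(\bar x,y)\ge 0\ \forall y\in K\}$. $F$ is monotone if $F(x,y)+F(y,x)\le 0$ for all $x,y\in K$. The resolvent of a bifunction $F$ is $J_F:X\rightrightarrows K$, $J_F(x):=\{z\in K: F(z,y)-\langle\overrightarrow{zx},\overrightarrow{zy}\rangle\ge 0\ \forall y\in K\}$, with $\operatorname{dom}(J_F):=\{x\in X:J_F(x)\ne\varnothing\}$; $J_{\mu F}$ is the resolvent of $\mu F$. For monotone $F$, $J_{\mu F}$ is single-valued on its domain. For a bounded sequence $(x^k)\subset X$ let $r(x;(x^k)):=\limsup_{k\to\infty}\rho(x,x^k)$;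 this function of $x$ has a unique minimizer over $X$. A bounded sequence $(x^k)$ is $\Delta$-convergent to $\bar x\in X$ if $\bar x=\operatorname{arg\,min}_{x\in X}r(x;(u^k))$ for every subsequence $(u^k)$ of $(x^k)$. A function $f:K\to\mathbb{R}$ is $\Delta$-upper semicontinuous if its hypograph is $\Delta$-closed (closed under $\Delta$-limits of sequences) in $X\times\mathbb{R}$, that is, $f(\bar x)\ge\limsup_k f(x^k)$ whenever $(x^k)\subset K$ is $\Delta$-convergent to $\bar x\in K$. *)

(* Defs.v *)
From HB Require Import structures.
From mathcomp Require Import all_boot all_order all_algebra.
From mathcomp Require Import all_classical all_reals all_analysis.

Set Implicit Arguments.
Unset Strict Implicit.
Unset Printing Implicit Defensive.

Import Order.TTheory GRing.Theory Num.Theory.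
Import numFieldNormedType.Exports.

Local Open Scope classical_set_scope.
Local Open Scope ring_scope.

Section Hadamard.
Context {R : realType} {X : metricType R}.
Implicit Types (x y z p q : X) (u : nat -> X) (K : set X) (F : X -> X -> R).

(* Unit-speed parametrization on [0, rho(x, y)]; values of c outside that
   interval are irrelevant. *)
Definition geodesic x y (c : R -> X) : Prop :=
  [/\ c 0 = x, c (mdist x y) = y &
      forall s t : R, 0 <= s <= mdist x y -> 0 <= t <= mdist x y ->
        mdist (c s) (c t) = `|s - t|].

Definition geodesic_space : Prop := forall x y, exists c, geodesic x y c.

(* The point z lies on a geodesic segment joining x and y. *)
Definition on_geodesic x y z : Prop :=
  exists (c : R -> X) (t : R), [/\ geodesic x y c, 0 <= t <= mdist x y & z = c t].

(* Euclidean distance of the plane; the library's norm on R * R is the sup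
   norm. *)
Definition plane_dist (a b : R * R) : R :=
  Num.sqrt ((a.1 - b.1) ^+ 2 + (a.2 - b.2) ^+ 2).

Definition comparison_triangle (p q r : X) (p' q' r' : R * R) : Prop :=
  [/\ plane_dist p' q' = mdist p q, plane_dist q' r' = mdist q r &
      plane_dist p' r' = mdist p r].

(* x' is the point of the Euclidean segment [p', q'] corresponding to the
   point x of a geodesic segment [p, q]. *)
Definition comparison_point (p q x : X) (p' q' x' : R * R) : Prop :=
  plane_dist p' x' = mdist p x /\ plane_dist x' q' = mdist x q.

(* Geodesic triangles are at least as thin as their comparison triangles.
   Comparing points on two sides issuing from p is enough, since p, q, r are
   arbitrary and since two points of the same side are at the same distance as
   their comparison points. *)
Definition CAT0 : Prop :=
  geodesic_space /\
  forall (p q r x y : X) (p' q' r' x' y' : R * R),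
    on_geodesic p q x -> on_geodesic p r y ->
    comparison_triangle p q r p' q' r' ->
    comparison_point p q x p' q' x' -> comparison_point p r y p' r' y' ->
    mdist x y <= plane_dist x' y'.

(* The axiom of completeType, without its requirement of a distinguished
   point. *)
Definition complete_space : Prop :=
  forall G : set_system X, ProperFilter G -> cauchy G -> exists x : X, G --> x.

Definition hadamard_space : Prop := complete_space /\ CAT0.

Definition geodesically_convex K : Prop :=
  forall x y z, K x -> K y -> on_geodesic x y z -> K z.

(* <xy, zw> for the bound vectors xy and zw. *)
Definition quasi_inner x y z w : R :=
  2^-1 * (mdist x w ^+ 2 + mdist y z ^+ 2 - mdist x z ^+ 2 - mdist y w ^+ 2).

Definition bounded_seq u : Prop := exists (p : X) (M : R), forall k, mdist p (u k) <= M.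

Definition asymptotic_radius u x : R := limn_sup (fun k => mdist x (u k)).

Definition asymptotic_centers u : set X :=
  [set x | forall y, asymptotic_radius u x <= asymptotic_radius u y].

Definition delta_cvg u x : Prop :=
  bounded_seq u /\
  forall phi : nat -> nat, increasing_seq phi ->
    asymptotic_centers (u \o phi) = [set x].

(* The limit superior is taken in the extended reals, as f \o u need not be
   bounded. *)
Definition delta_usc K (f : X -> R) : Prop :=
  forall u x, (forall k, K (u k)) -> K x -> delta_cvg u x ->
    (limn_esup (fun k => (f (u k))%:E) <= (f x)%:E)%E.

(* A bifunction F : K x K -> R is represented by a total function on X whose
   values outside K x K are never used. *)
Definition monotone_bifun K F : Prop :=
  forall x y, K x -> K y -> F x y + F y x <= 0.

Definition equilibria K F : set X :=
  [set x | K x /\ forall y, K y -> 0 <= F x y].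

Definition resolvent K F x : set X :=
  [set z | K z /\ forall y, K y -> 0 <= F z y - quasi_inner z x z y].

Definition resolvent_dom K F : set X := [set x | resolvent K F x !=set0].

Definition scale_bifun (mu : R) F : X -> X -> R := fun x y => mu * F x y.

End Hadamard.

Arguments geodesic_space {R} X.
Arguments CAT0 {R} X.
Arguments complete_space {R} X.
Arguments hadamard_space {R} X.

(* Main.v *)
(* Testing the resolvent inequality against an equilibrium p gives
   rho(p, x^k)^2 + rho(x^(k-1), x^k)^2 <= rho(p, x^(k-1))^2: the sequence is
   Fejer monotone with respect to the equilibria and its steps tend to 0.
   Testing it against any y in K then gives liminf F(x^k, y) >= 0, so that every
   Delta-limit of a subsequence, which lies in K because the projection onto K
   does not increase distances to points of K, is an equilibrium by upper
   semicontinuity.  Bounded sequences have Delta-convergent subsequences, and by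
   Fejer monotonicity the asymptotic radius at an equilibrium is the same for
   all subsequences; uniqueness of asymptotic centers then forces all these
   limits to coincide. *)
Require Import Defs.
From mathcomp Require Import all_boot all_order all_algebra.
From mathcomp Require Import all_classical all_reals all_analysis.
From mathcomp Require Import ring lra.

Import Order.TTheory GRing.Theory Num.Theory.
Import numFieldNormedType.Exports.

Local Open Scope classical_set_scope.
Local Open Scope ring_scope.

(** * Limits superior of bounded real sequences *)

(** [limn_sup] is the [lim] of [sups v], which is informative only if that limit exists; the bounds
    make [sups v] nonincreasing and bounded below, hence convergent to its infimum. *)
Lemma limn_sup_cvg_inf {R : realType} (v : nat -> R) (b : R) :
  (forall k, 0 <= v k <= b) ->
  has_lbound (range (sups v)) /\ limn_sup v = inf (range (sups v)).
Proof.
move=> vb.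
have ub : has_ubound (range v).
  by exists b => _ [k _ <-]; have /andP[] := vb k.
have lb : has_lbound (range v).
  by exists 0 => _ [k _ <-]; have /andP[] := vb k.
split; last by apply: cvg_lim => //; exact: cvg_sups_inf.
exists 0 => _ [n _ <-]; have /andP[v0 _] := vb n; apply: (le_trans v0).
by apply: ub_le_sup; [exact/has_ubound_sdrop|exists n => /=].
Qed.

Lemma limn_sup_le_near {R : realType} (v : nat -> R) (b M : R) :
  (forall k, 0 <= v k <= b) ->
  (exists N, forall k, (N <= k)%N -> v k <= M) -> limn_sup v <= M.
Proof.
move=> vb [N vM]; have [lb ->] := limn_sup_cvg_inf v b vb.
apply: (@le_trans _ _ (sups v N)); first by apply: ge_inf => //; exists N.
apply: ge_sup; first by exists (v N), N => /=.
by move=> _ [k /= Nk <-]; exact: vM.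
Qed.

Lemma limn_sup_lt_near {R : realType} (v : nat -> R) (b M : R) :
  (forall k, 0 <= v k <= b) ->
  limn_sup v < M -> exists N, forall k, (N <= k)%N -> v k <= M.
Proof.
move=> vb; have [lb ->] := limn_sup_cvg_inf v b vb.
have ne : range (sups v) !=set0 by exists (sups v 0%N), 0%N.
move=> /(inf_lt ne)[_ [N _ <-] NM]; exists N => k Nk; apply: (le_trans _ (ltW NM)).
apply: ub_le_sup; last by exists k.
by apply: has_ubound_sdrop; exists b => _ [i _ <-]; have /andP[] := vb i.
Qed.

(** * Subsequences and diagonal extraction *)

Lemma increasing_seq_ge (phi : nat -> nat) : increasing_seq phi ->
  forall k, (k <= phi k)%N.
Proof.
move=> inc; elim=> // k IH; apply: (leq_ltn_trans IH).
by rewrite ltnNge; have := inc k.+1 k; rewrite !leEnat => ->; rewrite ltnn.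
Qed.

Lemma increasing_seqS (phi : nat -> nat) :
  (forall k, (phi k < phi k.+1)%N) -> increasing_seq phi.
Proof. by move=> h; apply/increasing_seqP => k; exact: h. Qed.

Lemma increasing_seq_comp (phi psi : nat -> nat) :
  increasing_seq phi -> increasing_seq psi -> increasing_seq (phi \o psi).
Proof. by move=> h1 h2 m n; exact: etrans (h1 _ _) (h2 _ _). Qed.

(* Diagonal argument: the k-th step refines the current subsequence so that
   [f] gets within 1 / (k + 1) of its infimum over all refinements. *)
Lemma minimal_subsequence {R : realType} (f : (nat -> nat) -> R) :
    (forall phi, increasing_seq phi -> 0 <= f phi) ->
    (forall phi psi, increasing_seq phi -> increasing_seq psi ->
      (exists N, forall k, (N <= k)%N -> exists j, phi k = psi j) ->
      f phi <= f psi) ->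
  exists2 phi, increasing_seq phi &
    forall psi, increasing_seq psi -> f (phi \o psi) = f phi.
Proof.
move=> f0 fle.
have step (q : nat * (nat -> nat)) : exists psi, increasing_seq q.2 ->
    increasing_seq psi /\ forall theta, increasing_seq theta ->
      f (q.2 \o psi) <= f (q.2 \o theta) + q.1.+1%:R^-1.
  (* [id] is a junk value for index maps that are not increasing; [choice] asks for a total
     function. *)
  have [qinc|] := pselect (increasing_seq q.2); last by exists id.
  pose S := [set f (q.2 \o theta) | theta in [set t : nat -> nat | increasing_seq t]].
  have S0 : has_inf S.
    split; first by exists (f (q.2 \o id)), id.
    by exists 0 => _ [t tinc <-]; apply: f0; exact: increasing_seq_comp.
  have q0 : 0 < q.1.+1%:R^-1 :> R by rewrite invr_gt0.
  have [_ [psi pinc <-] plt] := inf_adherent q0 S0.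
  exists psi => _; split=> // t tinc; apply: (le_trans (ltW plt)).
  by rewrite lerD2r; apply: ge_inf; [case: S0|exists t].
have [g gP] := choice step.
pose Phi := fix Phi n := if n is m.+1 then Phi m \o g (m, Phi m) else id.
have Pinc n : increasing_seq (Phi n).
  elim: n => [//|n IH]; apply: increasing_seq_comp => //.
  by have [] := gP (n, Phi n) IH.
have Prange n k i : (n <= k)%N -> exists j, Phi k i = Phi n j.
  elim: k i => [|k IH] i; first by rewrite leqn0 => /eqP->; exists i.
  rewrite leq_eqVlt => /orP[/eqP->|]; first by exists i.
  by rewrite ltnS => /(IH (g (k, Phi k) i)).
pose D n := Phi n n.
have Dinc : increasing_seq D.
  apply: increasing_seqS => n; rewrite /D /=.
  have [ginc _] := gP (n, Phi n) (Pinc n).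
  rewrite ltnNge; have := Pinc n (g (n, Phi n) n.+1) n; rewrite !leEnat => ->.
  by rewrite -ltnNge; exact: increasing_seq_ge.
exists D => // psi pinc; apply/eqP; rewrite eq_le; apply/andP; split.
  apply: fle => //; first exact: increasing_seq_comp.
  by exists 0%N => k _; exists (psi k).
apply/ler_addgt0Pr => e e0.
have [n _ /(_ n (leqnn n)) /= ne] := near_infty_natSinv_lt (PosNum e0).
(* Dropping the first [n] terms of [D \o psi] leaves only values of [Phi n], so [w] is a refinement
   [Phi n \o t], which competes with the near-optimal [g (n, Phi n)]. *)
pose w k := D (psi (k + n)%N).
have winc : increasing_seq w.
  move=> i j; apply: etrans (Dinc _ _) _; apply: etrans (pinc _ _) _.
  exact: leq_add2r.
have /choice[t tP] k : exists j, w k = Phi n j.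
  by apply: Prange; apply: (leq_trans (leq_addl k n)); exact: increasing_seq_ge.
have tw : Phi n \o t = w by apply/funext => k; rewrite /= -tP.
have tinc : increasing_seq t.
  by move=> i j; rewrite leEnat -(Pinc n) -!tP; exact: winc.
have [_ gn] := gP (n, Phi n) (Pinc n).
apply: (@le_trans _ _ (f (Phi n.+1))).
  by apply: fle => //; exists n.+1 => k nk; exact: Prange.
apply: (le_trans (gn t tinc)) => /=; rewrite tw; apply: lerD; last exact: ltW.
apply: fle => //; first exact: increasing_seq_comp.
by exists 0%N => k _; exists (k + n)%N.
Qed.

Section HadamardSpaces.
Context {R : realType} {X : metricType R}.
Implicit Types (x y z m p : X) (u : nat -> X) (C K : set X).

(** * The quadratic form of the CAT(0) inequality *)

Lemma plane_distE (a b : R * R) (v : R) : 0 <= v ->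
  (a.1 - b.1) ^+ 2 + (a.2 - b.2) ^+ 2 = v ^+ 2 -> plane_dist a b = v.
Proof. by move=> v0 e; rewrite /plane_dist e sqrtr_sqr ger0_norm. Qed.

(** The comparison triangle is written in coordinates, with [x] at the origin and [y] on the first
    axis; in the plane the inequality is an equality, Stewart's identity. *)
Lemma CAT0_convex_sqr (hX : CAT0 X) x y (t : R) : 0 <= t <= 1 ->
  exists2 m, on_geodesic x y m & forall z,
    mdist z m ^+ 2 <= (1 - t) * mdist z x ^+ 2 + t * mdist z y ^+ 2
                      - t * (1 - t) * mdist x y ^+ 2.
Proof.
case: hX => geo cat /andP[t0 t1].
have [c gc] := geo x y; have [c0 c1 cd] := gc.
set d := mdist x y in c1 cd *; have d0 : 0 <= d by exact: mdist_ge0.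
have td : 0 <= t * d <= d by apply/andP; split; nra.
have xm : mdist x (c (t * d)) = t * d.
  rewrite -{1}c0 cd// ?lexx// sub0r normrN ger0_norm//.
  by case/andP: td.
have my : mdist (c (t * d)) y = (1 - t) * d.
  rewrite -{1}c1 cd// ?lexx ?d0// distrC ger0_norm; last by nra.
  by ring.
have mxy : on_geodesic x y (c (t * d)) by exists c, (t * d).
exists (c (t * d)) => // z.
have [d_eq0|d_neq0] := eqVneq d 0.
  have := xm; rewrite d_eq0 mulr0 => /mdist_positivity <-.
  have /mdist_positivity <- : mdist x y = 0 by [].
  by rewrite -subr_ge0 le_eqVlt; apply/orP; left; apply/eqP; ring.
have dp : 0 < d by rewrite lt_neqAle eq_sym d_neq0.
set m := c (t * d) in xm my mxy *.
rewrite (metric_sym z x) (metric_sym z y) (metric_sym z m).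
have b0 := mdist_ge0 x z; have e0 := mdist_ge0 y z.
have tr1 := metric_triangle x y z; have tr2 := metric_triangle y x z.
have tr3 := metric_triangle x z y.
rewrite (metric_sym z y) -/d in tr3; rewrite (metric_sym y x) -/d in tr2.
rewrite -/d in tr1.
set b := mdist x z in b0 tr1 tr2 tr3 *; set e := mdist y z in e0 tr1 tr2 tr3 *.
(* By the law of cosines [a] is the abscissa of the comparison point of [z]; its height [h] exists
   by Heron's factorization and the triangle inequalities. *)
pose a := (d ^+ 2 + b ^+ 2 - e ^+ 2) / (2 * d).
have ad : a * (2 * d) = d ^+ 2 + b ^+ 2 - e ^+ 2.
  by rewrite /a mulfVK// mulf_neq0.
have ab : 0 <= b ^+ 2 - a ^+ 2.
  rewrite -(pmulr_rge0 _ (_ : 0 < (2 * d) ^+ 2)); last by rewrite exprn_gt0// mulr_gt0.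
  have -> : (2 * d) ^+ 2 * (b ^+ 2 - a ^+ 2) =
      (e - d + b) * (e + d - b) * ((d + b - e) * (d + b + e)).
    transitivity ((2 * d * b) ^+ 2 - (a * (2 * d)) ^+ 2); first by ring.
    by rewrite ad; ring.
  by do ?apply: mulr_ge0; lra.
pose h := Num.sqrt (b ^+ 2 - a ^+ 2).
have hh : h ^+ 2 = b ^+ 2 - a ^+ 2 by rewrite sqr_sqrtr.
(* Taking the vertex [z] itself as the second point turns the comparison into a bound on the
   distance from [z] to [m]. *)
have zz : on_geodesic x z z.
  have [c' gc'] := geo x z; have [_ c'1 _] := gc'.
  by exists c', b; split; rewrite ?lexx ?b0.
have := cat x y z m z (0, 0) (d, 0) (a, h) (t * d, 0) (a, h) mxy zz.
have E1 : plane_dist ((0, 0) : R * R) (a, h) = b.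
  by apply: plane_distE => //=; rewrite !sub0r !sqrrN hh; ring.
have E2 : plane_dist (a, h) (a, h) = mdist z z.
  by rewrite mdistxx; apply: plane_distE => //=; ring.
have E3 : comparison_triangle x y z (0, 0) (d, 0) (a, h).
  split=> //; rewrite -/d -/e; apply: plane_distE => //=; first by ring.
  rewrite sub0r sqrrN hh; transitivity (d ^+ 2 + b ^+ 2 - a * (2 * d)); first by ring.
  by rewrite ad; ring.
have E4 : comparison_point x y m (0, 0) (d, 0) (t * d, 0).
  split; rewrite ?xm ?my; apply: plane_distE => /=; try ring.
  - by nra.
  - by nra.
have E5 : comparison_point x z z (0, 0) (a, h) (a, h) by split.
move=> /(_ E3 E4 E5) mz.
apply: (@le_trans _ _ (plane_dist (t * d, 0) (a, h) ^+ 2)).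
  by rewrite ler_sqr ?nnegrE ?sqrtr_ge0 ?mdist_ge0.
rewrite le_eqVlt; apply/orP; left; apply/eqP.
rewrite /plane_dist sqr_sqrtr ?addr_ge0 ?sqr_ge0//= sub0r sqrrN hh.
transitivity (b ^+ 2 + t ^+ 2 * d ^+ 2 - t * (a * (2 * d))); first by ring.
by rewrite ad; ring.
Qed.

(** * Minimization in complete spaces *)

(** Uniform convexity forces the sets of near-minimizers to shrink to diameter 0, so they generate a
    Cauchy filter, whose limit is a minimizer. *)
Lemma uniformly_convex_min (hX : complete_space X) C (f : X -> R) :
    closed C -> C !=set0 -> (forall x, 0 <= f x) ->
    (forall x y, f x <= f y + mdist x y) ->
    (forall x y, C x -> C y -> exists2 m, C m &
      f m ^+ 2 <= 2^-1 * f x ^+ 2 + 2^-1 * f y ^+ 2 - 4^-1 * mdist x y ^+ 2) ->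
  exists2 c, C c & forall y, C y -> f c <= f y.
Proof.
move=> Ccl [x0 Cx0] f0 flip fconv.
have fC0 : f @` C !=set0 by exists (f x0), x0.
have flb : has_lbound (f @` C) by exists 0 => _ [y _ <-].
set r := inf (f @` C).
have rle y : C y -> r <= f y by move=> Cy; apply: ge_inf => //; exists y.
have r0 : 0 <= r by apply: lb_le_inf => // _ [y _ <-].
pose A (e : R) := [set y | C y /\ f y <= r + e].
have Adist e x y : 0 < e -> A e x -> A e y -> mdist x y ^+ 2 <= 4 * e * (2 * r + e).
  move=> e0 [Cx fx] [Cy fy]; have [m Cm fm] := fconv x y Cx Cy.
  have rm : r ^+ 2 <= f m ^+ 2 by rewrite ler_sqr ?nnegrE ?rle.
  have re0 : 0 <= r + e by rewrite addr_ge0// ltW.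
  have fx2 : f x ^+ 2 <= (r + e) ^+ 2 by rewrite ler_sqr ?nnegrE.
  have fy2 : f y ^+ 2 <= (r + e) ^+ 2 by rewrite ler_sqr ?nnegrE.
  by nra.
have An0 e : 0 < e -> A e !=set0.
  move=> e0; have [_ [y Cy <-] ye] := inf_adherent e0 (conj fC0 flb).
  by exists y; split => //; exact: ltW.
pose G : set_system X := filter_from [set e : R | 0 < e] A.
have PG : ProperFilter G.
  apply: filter_from_proper; last by move=> e /=; exact: An0.
  apply: filter_from_filter; first by exists 1 => /=.
  move=> i j /= i0 j0; exists (Num.min i j) => /=; first by rewrite lt_min i0.
  move=> y [Cy fy]; split; split => //; apply: (le_trans fy); rewrite lerD2l.
  - by rewrite ge_min lexx.
  - by rewrite ge_min lexx orbT.
have cG : cauchy G.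
  apply/cauchy_exP => e /= e0.
  (* This gives [4 * d * (2 * r + d) <= d * (8 * r + 4) < e ^+ 2]. *)
  pose d := Num.min 1 (e ^+ 2 / (8 * r + 8)).
  have d0 : 0 < d by rewrite lt_min ltr01 divr_gt0 ?exprn_gt0//; lra.
  have [y Ay] := An0 d d0; exists y, d => //= z Az.
  rewrite ballEmdist /= -ltr_sqr ?nnegrE ?mdist_ge0 ?ltW//.
  apply: (le_lt_trans (Adist d y z d0 Ay Az)).
  have d1 : d <= 1 by rewrite ge_min lexx.
  have : d <= e ^+ 2 / (8 * r + 8) by rewrite ge_min lexx orbT.
  rewrite ler_pdivlMr; last by lra.
  nra.
have [c Gc] := hX G PG cG.
have near_c e : 0 < e -> exists2 y, A e y & mdist c y < e.
  move=> e0; have /Gc : nbhs c (ball c e) by exact: nbhsx_ballx.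
  move=> /= [d d0 dA]; have ed0 : 0 < Num.min e d by rewrite lt_min e0.
  have [y [Cy fy]] := An0 _ ed0; exists y.
    by split=> //; apply: (le_trans fy); rewrite lerD2l ge_min lexx.
  have : ball c e y.
    by apply: dA; split=> //; apply: (le_trans fy); rewrite lerD2l ge_min lexx orbT.
  by rewrite ballEmdist.
exists c.
  apply: Ccl => B /nbhs_ballP[e /= e0 eB].
  have [y [Cy _] cy] := near_c e e0; exists y; split=> //; apply: eB.
  by rewrite ballEmdist.
move=> y Cy; apply: (le_trans _ (rle y Cy)); apply/ler_addgt0Pr => e e0.
have [z [_ fz] cz] := near_c (e / 2) (divr_gt0 e0 (ltr0Sn _ _)).
by apply: (le_trans (flip c z)); lra.
Qed.

(** * Asymptotic radii and asymptotic centers *)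

Lemma bounded_seq_dist u : bounded_seq u ->
  forall x, exists b, forall k, 0 <= mdist x (u k) <= b.
Proof.
move=> [p [M uM]] x; exists (mdist x p + M) => k; rewrite mdist_ge0 /=.
by apply: (le_trans (metric_triangle x p _)); rewrite lerD2l.
Qed.

Lemma bounded_seq_comp u (phi : nat -> nat) :
  bounded_seq u -> bounded_seq (u \o phi).
Proof. by move=> [p [M uM]]; exists p, M => k; exact: uM. Qed.

Lemma asymptotic_radius_le u x (M : R) : bounded_seq u ->
  (exists N, forall k, (N <= k)%N -> mdist x (u k) <= M) ->
  asymptotic_radius u x <= M.
Proof.
by move=> /bounded_seq_dist/(_ x)[b ub]; exact: limn_sup_le_near ub.
Qed.

Lemma asymptotic_radius_lt u x (M : R) : bounded_seq u ->
  asymptotic_radius u x < M ->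
  exists N, forall k, (N <= k)%N -> mdist x (u k) <= M.
Proof.
by move=> /bounded_seq_dist/(_ x)[b ub]; exact: limn_sup_lt_near ub.
Qed.

(** Comparing radii through eventual bounds covers both passing to subsequences and moving the
    center. *)
Lemma asymptotic_radius_mono u v x y : bounded_seq u -> bounded_seq v ->
  (forall M, (exists N, forall k, (N <= k)%N -> mdist y (v k) <= M) ->
     exists N, forall k, (N <= k)%N -> mdist x (u k) <= M) ->
  asymptotic_radius u x <= asymptotic_radius v y.
Proof.
move=> bu bv uv; apply/ler_addgt0Pr => e e0.
apply: asymptotic_radius_le => //; apply: uv.
by apply: asymptotic_radius_lt => //; rewrite ltrDl.
Qed.

Lemma asymptotic_radius_ge0 u x : bounded_seq u -> 0 <= asymptotic_radius u x.
Proof.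
move=> bu; rewrite leNgt; apply/negP => r0.
have r2 : asymptotic_radius u x < asymptotic_radius u x / 2 by lra.
have [N /(_ N (leqnn N)) xM] := asymptotic_radius_lt _ _ _ bu r2.
have := mdist_ge0 x (u N); lra.
Qed.

Lemma asymptotic_radius_lip u x y : bounded_seq u ->
  asymptotic_radius u x <= asymptotic_radius u y + mdist x y.
Proof.
move=> bu; apply/ler_addgt0Pr => e e0; apply: asymptotic_radius_le => //.
have [N yM] := asymptotic_radius_lt u y (asymptotic_radius u y + e) bu
  (ltr_pwDr e0 (lexx _)).
exists N => k /yM yk; apply: (le_trans (metric_triangle x y _)); lra.
Qed.

(** The midpoint [m] does not depend on the terms of [u], so the quadratic inequality survives the
    limit superior, up to a slack [e]. *)
Lemma asymptotic_radius_convex (hX : CAT0 X) u x y : bounded_seq u ->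
  exists2 m, on_geodesic x y m & asymptotic_radius u m ^+ 2 <=
    2^-1 * asymptotic_radius u x ^+ 2 + 2^-1 * asymptotic_radius u y ^+ 2
    - 4^-1 * mdist x y ^+ 2.
Proof.
move=> bu; have h01 : 0 <= (2^-1 : R) <= 1 by apply/andP; split; lra.
have [m xym mP] := CAT0_convex_sqr hX x y 2^-1 h01; exists m => //.
have rx := asymptotic_radius_ge0 u x bu; have ry := asymptotic_radius_ge0 u y bu.
set a := asymptotic_radius u x in rx *; set b := asymptotic_radius u y in ry *.
have key e : 0 < e -> asymptotic_radius u m ^+ 2 <=
    2^-1 * (a + e) ^+ 2 + 2^-1 * (b + e) ^+ 2 - 4^-1 * mdist x y ^+ 2.
  move=> e0; set M := (X in _ <= X).
  have [N1 xN] := asymptotic_radius_lt u x (a + e) bu (ltr_pwDr e0 (lexx _)).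
  have [N2 yN] := asymptotic_radius_lt u y (b + e) bu (ltr_pwDr e0 (lexx _)).
  have mM k : (maxn N1 N2 <= k)%N -> mdist m (u k) ^+ 2 <= M.
    rewrite geq_max => /andP[/xN xk /yN yk]; have := mP (u k).
    rewrite !(metric_sym (u k)) /M => mk; apply: (le_trans mk).
    have := mdist_ge0 x (u k); have := mdist_ge0 y (u k) => y0 x0.
    have : mdist x (u k) ^+ 2 <= (a + e) ^+ 2 by rewrite ler_sqr ?nnegrE//; lra.
    have : mdist y (u k) ^+ 2 <= (b + e) ^+ 2 by rewrite ler_sqr ?nnegrE//; lra.
    by lra.
  (* Some term satisfies the bound, hence [M] is nonnegative and has a square root. *)
  have M0 : 0 <= M by apply: (le_trans _ (mM _ (leqnn _))); exact: sqr_ge0.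
  rewrite -(sqr_sqrtr M0) ler_sqr ?nnegrE ?sqrtr_ge0 ?asymptotic_radius_ge0//.
  apply: asymptotic_radius_le => //; exists (maxn N1 N2) => k /mM mk.
  by rewrite -(ger0_norm (mdist_ge0 m (u k))) -sqrtr_sqr ler_wsqrtr.
apply/ler_addgt0Pr => e e0.
(* After expanding the squares, a slack [d <= 1] costs at most [d * (a + b + 1) <= e]. *)
pose d := Num.min 1 (e / (a + b + 1)).
have ab : 0 < a + b + 1 by lra.
have d0 : 0 < d by rewrite lt_min ltr01 divr_gt0.
have d1 : d <= 1 by rewrite ge_min lexx.
have : d <= e / (a + b + 1) by rewrite ge_min lexx orbT.
rewrite ler_pdivlMr// => de; apply: (le_trans (key d d0)); nra.
Qed.

(** Otherwise the midpoint of [x] and [y] would have a strictly smaller radius than [x]. *)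
Lemma asymptotic_center_unique (hX : CAT0 X) u x y : bounded_seq u ->
  asymptotic_centers u x -> asymptotic_radius u y <= asymptotic_radius u x ->
  y = x.
Proof.
move=> bu cx yx; have [m _ mP] := asymptotic_radius_convex hX u y x bu.
have xm : asymptotic_radius u x ^+ 2 <= asymptotic_radius u m ^+ 2.
  by rewrite ler_sqr ?nnegrE ?asymptotic_radius_ge0//; exact: cx.
have yx2 : asymptotic_radius u y ^+ 2 <= asymptotic_radius u x ^+ 2.
  by rewrite ler_sqr ?nnegrE ?asymptotic_radius_ge0.
apply: mdist_positivity; apply/eqP; rewrite -sqrf_eq0 eq_le sqr_ge0 andbT; lra.
Qed.

Lemma asymptotic_centers_eq1 (hX : CAT0 X) u x : bounded_seq u ->
  asymptotic_centers u x -> asymptotic_centers u = [set x].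
Proof.
move=> bu cx; apply/seteqP; split=> [y cy|_ ->//].
by apply: (asymptotic_center_unique hX u) => //; exact: cy.
Qed.

Lemma asymptotic_center_exists (hX : hadamard_space X) u : bounded_seq u ->
  exists c, asymptotic_centers u c.
Proof.
move: hX => [cX hX] bu; have := uniformly_convex_min cX setT (asymptotic_radius u).
case.
- exact: closedT.
- by exists (u 0%N).
- by move=> x; exact: asymptotic_radius_ge0.
- by move=> x y; exact: asymptotic_radius_lip.
- move=> x y _ _; have [m _ mP] := asymptotic_radius_convex hX u x y bu.
  by exists m.
- by move=> c _ cP; exists c => y; exact: cP.
Qed.

(** * Projection onto closed convex sets *)

Lemma nonexpansive_projection (hX : hadamard_space X) K z : closed K ->
    geodesically_convex K -> K !=set0 ->
  exists2 q, K q & forall y, K y -> mdist q y <= mdist z y.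
Proof.
move: hX => [cX hX] Kcl Kconv K0.
have [] := uniformly_convex_min cX K (mdist z) => //.
- by move=> x; exact: mdist_ge0.
- move=> x y; apply: (le_trans (metric_triangle z y x)).
  by rewrite (metric_sym y x).
- move=> x y Kx Ky; have h01 : 0 <= (2^-1 : R) <= 1 by apply/andP; split; lra.
  have [m xym /(_ z) mP] := CAT0_convex_sqr hX x y 2^-1 h01.
  by exists m; [exact: Kconv xym|lra].
move=> q Kq qmin; exists q => // y Ky.
rewrite -ler_sqr ?nnegrE ?mdist_ge0//.
(* Comparing [z] with the point at ratio t of the segment [q, y] and letting t
   go to 0 gives the obtuse angle inequality. *)
suff : mdist z q ^+ 2 + mdist q y ^+ 2 <= mdist z y ^+ 2.
  by have := sqr_ge0 (mdist z q); lra.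
rewrite leNgt; apply/negP => lt.
have q0 := sqr_ge0 (mdist q y); have z0 := sqr_ge0 (mdist z y).
set A := mdist z q ^+ 2 in lt; set B := mdist q y ^+ 2 in lt q0.
set D := mdist z y ^+ 2 in lt z0.
have A0 : 0 <= A by exact: sqr_ge0.
(* With this ratio [t * B] is at most half of the supposed excess [A + B - D > 0], which contradicts
   the minimality of [q] at the point [m]. *)
pose t := (A + B - D) / (2 * (A + B)).
have AB : 0 < 2 * (A + B) by lra.
have tAB : t * (2 * (A + B)) = A + B - D by rewrite /t mulfVK// gt_eqF.
have t0 : 0 < t by rewrite divr_gt0//; lra.
have t1 : t <= 1 by rewrite ler_pdivrMr//; lra.
have t01 : 0 <= t <= 1 by rewrite ltW.
have [m qym /(_ z) mP] := CAT0_convex_sqr hX q y t t01.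
have : A <= mdist z m ^+ 2.
  by rewrite ler_sqr ?nnegrE ?mdist_ge0//; apply: qmin; exact: Kconv qym.
rewrite -/A -/B -/D in mP => Am.
have : t * (A + B - D - t * B) <= 0 by lra.
rewrite pmulr_rle0//; nra.
Qed.

(** Projecting [c] onto [K] does not increase its asymptotic radius, so uniqueness of the center
    identifies [c] with its projection. *)
Lemma asymptotic_center_in (hX : hadamard_space X) K u c : closed K ->
    geodesically_convex K -> (forall k, K (u k)) -> bounded_seq u ->
  asymptotic_centers u c -> K c.
Proof.
move=> Kcl Kconv Ku bu cc.
have [|q Kq qP] := nonexpansive_projection hX K c Kcl Kconv.
  by exists (u 0%N).
suff <- : q = c by [].
apply: (asymptotic_center_unique (proj2 hX) u) => //.
apply: asymptotic_radius_mono => // M [N cM]; exists N => k /cM; apply: le_trans.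
exact: qP.
Qed.

(** * Delta-convergent subsequences and Fejer monotone sequences *)

(** A subsequence is chosen whose minimal radius is unchanged by further refinement; its center then
    attains the minimal radius of each of its subsequences, hence is their common center. *)
Lemma delta_cvg_subsequence (hX : hadamard_space X) u : bounded_seq u ->
  exists phi c, increasing_seq phi /\ delta_cvg (u \o phi) c.
Proof.
move=> bu; have bphi phi := bounded_seq_comp u phi bu.
pose f phi := inf (range (asymptotic_radius (u \o phi))).
have flb phi : has_lbound (range (asymptotic_radius (u \o phi))).
  by exists 0 => _ [x _ <-]; exact: asymptotic_radius_ge0.
have fne phi : range (asymptotic_radius (u \o phi)) !=set0.
  by exists (asymptotic_radius (u \o phi) (u 0%N)), (u 0%N).
have f0 phi : increasing_seq phi -> 0 <= f phi.
  by move=> _; apply: lb_le_inf => // _ [x _ <-]; exact: asymptotic_radius_ge0.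
have rle phi psi x : increasing_seq phi -> increasing_seq psi ->
    (exists N, forall k, (N <= k)%N -> exists j, phi k = psi j) ->
    asymptotic_radius (u \o phi) x <= asymptotic_radius (u \o psi) x.
  move=> iphi ipsi [N phipsi]; apply: asymptotic_radius_mono => // M [J xM].
  (* From [psi J <= k <= phi k = psi j] it follows that [J <= j]. *)
  exists (maxn N (psi J)) => k; rewrite geq_max => /andP[Nk Jk].
  have [j kj] := phipsi k Nk; rewrite /= kj; apply: xM.
  have := leq_trans Jk (increasing_seq_ge phi iphi k); rewrite kj.
  by rewrite -leEnat ipsi.
have [||phi iphi phimin] := minimal_subsequence f.
- exact: f0.
- move=> phi psi iphi ipsi h; apply: lb_le_inf => // _ [x _ <-].
  apply: (le_trans _ (rle phi psi x iphi ipsi h)).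
  by apply: ge_inf => //; exists x.
have [c cc] := asymptotic_center_exists hX _ (bphi phi).
exists phi, c; split=> //; split=> // psi ipsi.
apply: asymptotic_centers_eq1 (proj2 hX) _ _ _ _; first exact: bphi.
move=> y; rewrite -[_ \o psi]/(u \o (phi \o psi)).
apply: (@le_trans _ _ (asymptotic_radius (u \o phi) c)).
  apply: rle => //; first exact: increasing_seq_comp.
  by exists 0%N => k _; exists (psi k).
apply: (@le_trans _ _ (f phi)); first by apply: lb_le_inf => // _ [x _ <-].
by rewrite -(phimin psi ipsi); apply: ge_inf => //; exists y.
Qed.

Lemma delta_cvg_fejer (hX : hadamard_space X) (E : set X) u : E !=set0 ->
    (forall p k, E p -> mdist p (u k.+1) <= mdist p (u k)) ->
    (forall phi c, increasing_seq phi -> delta_cvg (u \o phi) c -> E c) ->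
  exists2 c, E c & delta_cvg u c.
Proof.
move=> [p0 Ep0] fejer clusterE.
have mono p (m n : nat) : E p -> (m <= n)%N -> mdist p (u n) <= mdist p (u m).
  move=> Ep /subnK <-; elim: (n - m)%N => [//|i IH].
  exact: le_trans (fejer _ _ Ep) IH.
have bu : bounded_seq u by exists p0, (mdist p0 (u 0%N)) => k; exact: mono.
have bphi phi := bounded_seq_comp u phi bu.
have rsub phi y : increasing_seq phi ->
    asymptotic_radius (u \o phi) y <= asymptotic_radius u y.
  move=> iphi; apply: asymptotic_radius_mono => // M [N yM]; exists N => k Nk.
  by apply: yM; apply: (leq_trans Nk); exact: increasing_seq_ge.
(* Distances to [p] do not increase along [u], so a bound at the single index [phi N] holds from
   there on. *)
have rE phi p : E p -> asymptotic_radius u p <= asymptotic_radius (u \o phi) p.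
  move=> Ep; apply: asymptotic_radius_mono => // M [N pM]; exists (phi N) => k Nk.
  exact: le_trans (mono _ _ _ Ep Nk) (pM N (leqnn N)).
have centerE psi : increasing_seq psi ->
    exists2 c, E c & asymptotic_centers (u \o psi) c.
  move=> ipsi; have [phi [c [iphi uc]]] := delta_cvg_subsequence hX _ (bphi psi).
  have ipp := increasing_seq_comp _ _ ipsi iphi.
  have Ec : E c by exact: (clusterE (psi \o phi)).
  exists c => // y; apply: (le_trans (rsub _ _ ipsi)).
  apply: (le_trans (rE (psi \o phi) c Ec)).
  (* The choice [id] shows that [c] is a center of the extracted subsequence itself. *)
  have [_ /(_ id) ucid] := uc.
  have cc : asymptotic_centers (u \o psi \o phi \o id) c by rewrite ucid.
  apply: (le_trans (cc y)).
  apply: asymptotic_radius_mono; [exact: (bphi (psi \o phi))|exact: bphi|].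
  move=> M [N yM]; exists N => k Nk; apply: yM; apply: (leq_trans Nk).
  exact: increasing_seq_ge.
have [|c Ec cc] := centerE id; first by [].
exists c => //; split=> // psi ipsi; have [d Ed dc] := centerE psi ipsi.
(* The radius of [u] at [d] is at most that of [u \o psi] at [d], hence at [c], hence at most that
   of [u] at [c]. *)
have -> : c = d; last by apply: asymptotic_centers_eq1 (proj2 hX) _ _ _ dc.
apply/esym/(asymptotic_center_unique (proj2 hX) u) => //.
by apply: (le_trans (rE psi d Ed)); apply: (le_trans (dc c)); exact: rsub.
Qed.

(** * Resolvents and the proximal sequence *)

Lemma resolvent_ineq K (F : X -> X -> R) (mu : R) x z y :
  resolvent K (scale_bifun mu F) x z -> K y ->
  mdist z y ^+ 2 + mdist x z ^+ 2 - mdist x y ^+ 2 <= 2 * (mu * F z y).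
Proof.
move=> [_ zP] /zP; rewrite /scale_bifun /quasi_inner mdistxx expr0n /= subr0.
lra.
Qed.

End HadamardSpaces.

Lemma limn_esup_ge_near {R : realType} (v : nat -> \bar R) (l : \bar R) :
  (exists N, forall k, (N <= k)%N -> (l <= v k)%E) -> (l <= limn_esup v)%E.
Proof.
move=> [N vl]; rewrite limn_esup_lim; apply: lime_ge; first exact: is_cvg_esups.
apply: nearW => n; apply: (le_trans (vl (maxn n N) (leq_maxr _ _))).
by apply: ereal_sup_ubound; exists (maxn n N) => //=; exact: leq_maxl.
Qed.

Theorem theorem7p3 (R : realType) (X : metricType R) (hX : hadamard_space X)
  (K : set X) (K_neq0 : K !=set0) (K_closed : closed K)
  (K_convex : geodesically_convex K)
  (F : X -> X -> R) (F_monotone : monotone_bifun K F)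
  (E_neq0 : equilibria K F !=set0)
  (F_usc : forall y, K y -> delta_usc K (fun x => F x y))
  (F_dom : forall mu : R, 0 < mu -> K `<=` resolvent_dom K (scale_bifun mu F))
  (lambda : nat -> R) (lambda_gt0 : forall k, (0 < k)%N -> 0 < lambda k)
  (lambda_away : exists2 e : R, 0 < e & forall k, (0 < k)%N -> e <= lambda k)
  (x : nat -> X) (x0K : K (x 0%N))
  (x_prox : forall k, (0 < k)%N ->
    resolvent K (scale_bifun (lambda k) F) (x k.-1) (x k)) :
  exists2 xbar, equilibria K F xbar & delta_cvg x xbar.
Proof.
have xK k : K (x k) by case: k => [//|k]; have [] := x_prox k.+1 isT.
have prox k y : K y -> mdist (x k.+1) y ^+ 2 + mdist (x k) (x k.+1) ^+ 2
    - mdist (x k) y ^+ 2 <= 2 * (lambda k.+1 * F (x k.+1) y).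
  exact: resolvent_ineq (x_prox k.+1 isT).
have fejer p k : equilibria K F p ->
    mdist p (x k.+1) ^+ 2 + mdist (x k) (x k.+1) ^+ 2 <= mdist p (x k) ^+ 2.
  move=> [Kp /(_ _ (xK k.+1)) Fp]; have := prox k p Kp.
  rewrite !(metric_sym _ p) => h.
  (* As [F p (x k.+1)] is nonnegative, monotonicity gives [F (x k.+1) p <= 0]. *)
  have Fm := F_monotone _ _ Kp (xK k.+1); have l0 := lambda_gt0 k.+1 isT.
  have : lambda k.+1 * F (x k.+1) p <= 0 by rewrite pmulr_rle0//; lra.
  lra.
have fejer_dist p k : equilibria K F p -> mdist p (x k.+1) <= mdist p (x k).
  move=> Ep; rewrite -ler_sqr ?nnegrE ?mdist_ge0//.
  by have := fejer p k Ep; have := sqr_ge0 (mdist (x k) (x k.+1)); lra.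
have [p0 Ep0] := E_neq0.
have step0 e : 0 < e -> exists N, forall k, (N <= k)%N -> mdist (x k) (x k.+1) <= e.
  move=> e0; pose a k := mdist p0 (x k) ^+ 2.
  have ainf : has_inf (range a).
    split; first by exists (a 0%N), 0%N.
    by exists 0 => _ [k _ <-]; exact: sqr_ge0.
  (* Once [a N] is within [e ^+ 2] of the infimum, all later decrements of [a], which dominate the
     squared steps, are below [e ^+ 2]. *)
  have [_ [N _ <-] aN] := inf_adherent (exprn_gt0 2 e0) ainf.
  exists N => k Nk; rewrite -ler_sqr ?nnegrE ?mdist_ge0 ?(ltW e0)//.
  have akN : a k <= a N.
    move: Nk => /subnK <-; elim: (k - N)%N => [//|i IH]; apply: le_trans IH.
    by rewrite ler_sqr ?nnegrE ?mdist_ge0//; exact: fejer_dist.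
  have ai : inf (range a) <= a k.+1 by apply: ge_inf; [case: ainf|exists k.+1].
  have := fejer p0 k Ep0; rewrite -/(a k) -/(a k.+1); lra.
apply: (delta_cvg_fejer hX _ _ E_neq0) => [p k Ep|phi c iphi xc].
  exact: fejer_dist.
have bx : bounded_seq (x \o phi) by case: xc.
have Kc : K c.
  apply: (asymptotic_center_in hX K (x \o phi \o id)) => //.
  - by move=> k; exact: xK.
  - by have [_ ->] := xc.
split=> // y Ky.
have [e e0 el] := lambda_away.
(* [B] bounds all distances from the sequence to [y]; the [1] makes it positive, as it serves as a
   divisor. *)
pose B := mdist p0 (x 0%N) + mdist p0 y + 1.
have B0 : 0 < B by rewrite ltr_wpDl// addr_ge0// mdist_ge0.
have xyB k : mdist (x k) y <= B.
  have : mdist p0 (x k) <= mdist p0 (x 0%N).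
    by elim: k => [//|k IH]; exact: le_trans (fejer_dist _ _ Ep0) IH.
  by have := metric_triangle (x k) p0 y; rewrite (metric_sym (x k) p0) /B; lra.
have Fe d : 0 < d -> exists N, forall k, (N <= k)%N -> - d <= F (x k) y.
  (* A step of at most [d * e / B] changes the squared distance to [y] by at most [2 * d * e], so
     [lambda k.+1 * F (x k.+1) y >= - (d * e)]; then [lambda k.+1 >= e] yields the bound on [F]. *)
  move=> d0; have [N xN] := step0 (d * e / B) (divr_gt0 (mulr_gt0 d0 e0) B0).
  exists N.+1 => -[//|k]; rewrite ltnS => /xN; rewrite ler_pdivlMr// => xk.
  have Pk := prox k y Ky; have lk := el k.+1 isT.
  have t1 := metric_triangle (x k) (x k.+1) y.
  have xy1 := xyB k; have xy2 := xyB k.+1.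
  have := mdist_ge0 (x k) y; have := mdist_ge0 (x k.+1) y.
  have := mdist_ge0 (x k) (x k.+1) => s0 y1 y0.
  have lF : - (d * e) <= lambda k.+1 * F (x k.+1) y by nra.
  rewrite leNgt; apply/negP => Fd; nra.
apply/ler_addgt0Pr => d d0; rewrite -lerBlDr sub0r.
rewrite -lee_fin; apply: (le_trans _ (F_usc y Ky (x \o phi) c _ Kc xc)).
  apply: limn_esup_ge_near; have [N FN] := Fe d d0; exists N => k Nk.
  rewrite lee_fin; apply: FN; apply: (leq_trans Nk).
  exact: increasing_seq_ge.
by move=> k; exact: xK.
Qed.
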